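(* The function $f(x)=\psi(1/\cosh(x))$ is decreasing and convex from $(0,\infty)$ onto $(0,\infty)$. In particular, for $r,s\in(0,1)$, with $r'=\sqrt{1-r^2}$ and $s'=\sqrt{1-s^2}$, $$2\psi\left(\frac{\sqrt{2rs}}{\sqrt{1+rs+r's'}}\right)\leq\psi(r)+\psi(s),$$ with equality if and only if $r=s$.
   Context: For $0<r<1$ let $\mathcal{K}(r)=\int_0^{\pi/2}\frac{dt}{\sqrt{1-r^2\sin^2t}}$ and $\mathcal{E}(r)=\int_0^{\pi/2}\sqrt{1-r^2\sin^2t}\,dt$ be the complete elliptic integrals of the first and second kind (argument is the modulus $r$). Put $r'=\sqrt{1-r^2}$, $\mathcal{K}'(r)=\mathcal{K}(r')$, $\mathcal{E}'(r)=\mathcal{E}(r')$ (the prime on $\mathcal{K},\mathcal{E}$ is not a derivative). The function $\psi:(0,1)\to(0,\infty)$ is defined by $$\psi(r)=\frac{2(\mathcal{E}(r)-(1-r)\mathcal{K}(r))}{\mathcal{E}'(r)-r\mathcal{K}'(r)}.$$ *)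

(* Defs.v *)
From Stdlib Require Import Reals.
From Coquelicot Require Import Coquelicot.
Open Scope R_scope.

(* The argument of the elliptic integrals is the modulus r, not the
   parameter m = r ^ 2. *)
Definition ellK (r : R) : R :=
  RInt (fun t => 1 / sqrt (1 - r ^ 2 * sin t ^ 2)) 0 (PI / 2).

Definition ellE (r : R) : R :=
  RInt (fun t => sqrt (1 - r ^ 2 * sin t ^ 2)) 0 (PI / 2).

Definition comodulus (r : R) : R := sqrt (1 - r ^ 2).

Definition ellK' (r : R) : R := ellK (comodulus r).
Definition ellE' (r : R) : R := ellE (comodulus r).

(* Only the values on the open interval (0, 1) are meaningful. *)
Definition psi (r : R) : R :=
  2 * (ellE r - (1 - r) * ellK r) / (ellE' r - r * ellK' r).

Definition pos_reals (x : R) : Prop := 0 < x.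

Definition maps_onto (f : R -> R) (D E : R -> Prop) : Prop :=
  (forall x, D x -> E (f x)) /\
  (forall y, E y -> exists x, D x /\ f x = y).

(* "Decreasing" is read strictly. *)
Definition decreasing_on (f : R -> R) (D : R -> Prop) : Prop :=
  forall x y, D x -> D y -> x < y -> f y < f x.

(* Meant for D an interval, so that the convex combination stays in D. *)
Definition convex_on (f : R -> R) (D : R -> Prop) : Prop :=
  forall x y t, D x -> D y -> 0 <= t <= 1 ->
    f (t * x + (1 - t) * y) <= t * f x + (1 - t) * f y.

(* Main.v *)
(* Write psi = 2 N / D with N = E - (1 - r) K and D = E' - r K'. Then
   dN/dr = E / (1 + r) and dD/dr = (E' - K') / (1 + r), so that
   dpsi/dr = 2 (1 - r) L / ((1 + r) D^2), where L = E K' + K E' - K K' is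
   constant and positive. For f(x) = psi(1 / cosh x) this makes f'(x) negative,
   and f'(x)^2 equals 4 L^2 G(r) at r = 1 / cosh x with
   G(r) = r^2 (1 - r)^3 / ((1 + r) D^4). Strict convexity of f amounts to G
   being increasing, that is, to H = (1 - 4 r) E' + r (1 + 2 r^2) K' > 0 on
   (0, 1). At any point where H <= 0 the derivative of H is negative; since
   H > 0 on (0, 1/4] and H(1) = 0, such a point would force an interior minimum
   with negative derivative. The inequality is strict midpoint convexity, as
   its argument is 1 / cosh((x + y) / 2) when r = 1 / cosh x, s = 1 / cosh y. *)
Require Import Defs.
From Stdlib Require Import Reals Ranalysis5 Lra ssreflect.
From Coquelicot Require Import Coquelicot.
Open Scope R_scope.

(** * Differentiation under the integral sign *)

Lemma delta_pos (m t : R) : m < 1 -> 0 < 1 - m * sin t ^ 2.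
Proof.
intros Hm.
assert (H := sin2_cos2 t); unfold Rsqr in H.
assert (H1 := pow2_ge_0 (sin t)); assert (H2 := pow2_ge_0 (cos t)).
destruct (Rle_dec m 0); nra.
Qed.

Lemma sqrt_delta_pos (m t : R) : m < 1 -> 0 < sqrt (1 - m * sin t ^ 2).
Proof. intros Hm; apply sqrt_lt_R0, delta_pos, Hm. Qed.

Lemma continuous_delta_comp (F : R -> R) (m t : R) :
  (forall w, 0 < w -> continuous F w) -> m < 1 ->
  continuous (fun u => F (1 - m * sin u ^ 2)) t.
Proof.
intros HF Hm.
apply (continuous_comp (fun u => 1 - m * sin u ^ 2) F).
- apply: ex_derive_continuous; auto_derive; trivial.
- apply HF, delta_pos, Hm.
Qed.

Lemma ex_RInt_delta_comp (F : R -> R) (m a b : R) :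
  (forall w, 0 < w -> continuous F w) -> m < 1 ->
  ex_RInt (fun t => F (1 - m * sin t ^ 2)) a b.
Proof.
intros HF Hm; apply: ex_RInt_continuous => t _.
now apply continuous_delta_comp.
Qed.

(** Covers both integrals at once, with [F] equal to [sqrt] or to its reciprocal. Smoothness of [F]
    on the positive reals suffices, since [delta_pos] keeps its argument there. *)
Lemma is_derive_RInt_delta (F dF : R -> R) (m a b : R) :
  (forall w, 0 < w -> is_derive F w (dF w)) ->
  (forall w, 0 < w -> continuous dF w) -> m < 1 ->
  is_derive (fun m => RInt (fun t => F (1 - m * sin t ^ 2)) a b) m
    (RInt (fun t => - sin t ^ 2 * dF (1 - m * sin t ^ 2)) a b).
Proof.
intros HF HdF Hm.
assert (HFc : forall w, 0 < w -> continuous F w).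
{ intros w Hw; apply: ex_derive_continuous; exists (dF w); now apply HF. }
assert (Hd : forall n t, n < 1 ->
  is_derive (fun u => F (1 - u * sin t ^ 2)) n
    (- sin t ^ 2 * dF (1 - n * sin t ^ 2))).
{ intros n t Hn.
  apply (is_derive_comp F (fun u => 1 - u * sin t ^ 2)).
  - now apply HF, delta_pos.
  - auto_derive; trivial; ring. }
assert (Hloc : locally m (fun n => n < 1)) by now apply open_lt.
replace (RInt _ a b) with
  (RInt (fun t => Derive (fun u => F (1 - u * sin t ^ 2)) m) a b).
2:{ apply RInt_ext => t _; now apply is_derive_unique, Hd. }
apply (is_derive_RInt_param (fun u t => F (1 - u * sin t ^ 2))).
- apply: filter_imp Hloc => n Hn t _; eexists; now apply Hd.
- intros t _.
  (* The explicit partial derivative is available only for parameters below 1, hence only locally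
     around [m]. *)
  apply continuity_2d_pt_ext_loc with
    (fun u v => - sin v ^ 2 * dF (1 - u * sin v ^ 2)).
  + destruct Hloc as [d Hloc]; exists d => u v Hu _.
    symmetry; apply is_derive_unique, Hd, Hloc, Hu.
  + assert (Hs : continuity_2d_pt (fun _ v => sin v ^ 2) m t).
    { apply (continuity_1d_2d_pt_comp (fun v => sin v ^ 2)).
      - apply derivable_continuous_pt; reg.
      - apply continuity_2d_pt_id2. }
    apply continuity_2d_pt_mult.
    * now apply continuity_2d_pt_opp.
    * apply (continuity_1d_2d_pt_comp dF).
      -- now apply continuity_pt_filterlim, HdF, delta_pos.
      -- apply continuity_2d_pt_minus.
         ++ apply continuity_2d_pt_const.
         ++ apply continuity_2d_pt_mult; trivial; apply continuity_2d_pt_id1.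
- apply: filter_imp Hloc => n Hn; now apply ex_RInt_delta_comp.
Qed.

(* The complete integrals in terms of the parameter [m = r ^ 2]; they are smooth
   for all [m < 1], including at [m = 0]. *)
Definition parK (m : R) : R :=
  RInt (fun t => 1 / sqrt (1 - m * sin t ^ 2)) 0 (PI / 2).
Definition parE (m : R) : R :=
  RInt (fun t => sqrt (1 - m * sin t ^ 2)) 0 (PI / 2).

(** * Derivatives of the complete integrals in the parameter *)

Lemma is_derive_inv_sqrt (w : R) : 0 < w ->
  is_derive (fun w => 1 / sqrt w) w (- / (2 * w * sqrt w)).
Proof.
intros Hw; assert (Hs := sqrt_lt_R0 _ Hw).
auto_derive; [ split; [ | split]; trivial; lra | ].
rewrite sqrt_sqrt; [field | ]; lra.
Qed.

Lemma is_derive_sqrt_pos (w : R) : 0 < w ->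
  is_derive sqrt w (1 / sqrt w / 2).
Proof.
intros Hw; assert (Hs := sqrt_lt_R0 _ Hw).
auto_derive; trivial; field; lra.
Qed.

Lemma continuous_inv_sqrt (w : R) : 0 < w -> continuous (fun w => 1 / sqrt w) w.
Proof.
intros Hw; apply: ex_derive_continuous; eexists; now apply is_derive_inv_sqrt.
Qed.

Lemma continuous_sqrt_pos (w : R) : 0 < w -> continuous sqrt w.
Proof.
intros Hw; apply: ex_derive_continuous; eexists; now apply is_derive_sqrt_pos.
Qed.

Lemma is_RInt_parK (m : R) : m < 1 ->
  is_RInt (fun t => 1 / sqrt (1 - m * sin t ^ 2)) 0 (PI / 2) (parK m).
Proof.
intros Hm; apply (RInt_correct (V := R_CompleteNormedModule)).
apply (ex_RInt_delta_comp (fun w => 1 / sqrt w)); trivial.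
exact continuous_inv_sqrt.
Qed.

Lemma is_RInt_parE (m : R) : m < 1 ->
  is_RInt (fun t => sqrt (1 - m * sin t ^ 2)) 0 (PI / 2) (parE m).
Proof.
intros Hm; apply (RInt_correct (V := R_CompleteNormedModule)).
apply (ex_RInt_delta_comp sqrt); trivial.
exact continuous_sqrt_pos.
Qed.

(** The integral form of the derivative is valid at [m = 0] as well, where the closed form below
    divides by zero; continuity at that point rests on it. *)
Lemma is_derive_parE_RInt (m : R) : m < 1 ->
  is_derive parE m (RInt
    (fun t => - sin t ^ 2 * (1 / sqrt (1 - m * sin t ^ 2) / 2)) 0 (PI / 2)).
Proof.
apply (is_derive_RInt_delta sqrt (fun w => 1 / sqrt w / 2)).
- exact is_derive_sqrt_pos.
- intros w Hw; apply: ex_derive_continuous; auto_derive.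
  assert (Hs := sqrt_lt_R0 _ Hw); repeat split; trivial; lra.
Qed.

Lemma is_derive_parK_RInt (m : R) : m < 1 ->
  is_derive parK m (RInt (fun t => - sin t ^ 2 *
    (- / (2 * (1 - m * sin t ^ 2) * sqrt (1 - m * sin t ^ 2)))) 0 (PI / 2)).
Proof.
apply (is_derive_RInt_delta (fun w => 1 / sqrt w)
  (fun w => - / (2 * w * sqrt w))).
- exact is_derive_inv_sqrt.
- intros w Hw; apply: ex_derive_continuous; auto_derive.
  assert (Hs := sqrt_lt_R0 _ Hw); repeat split; trivial; nra.
Qed.

(** The two integrands agree pointwise: with [q = sqrt (1 - m * sin t ^ 2)], one has
    [q - 1 / q = - m * sin t ^ 2 / q]. *)
Lemma is_derive_parE (m : R) : m < 1 -> m <> 0 ->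
  is_derive parE m ((parE m - parK m) / (2 * m)).
Proof.
intros Hm Hm0.
replace (_ / _) with (RInt
  (fun t => - sin t ^ 2 * (1 / sqrt (1 - m * sin t ^ 2) / 2)) 0 (PI / 2)).
{ now apply is_derive_parE_RInt. }
apply is_RInt_unique.
apply is_RInt_ext with (fun t => scal (/ (2 * m))
  (minus (sqrt (1 - m * sin t ^ 2)) (1 / sqrt (1 - m * sin t ^ 2)))).
- intros t _.
  assert (Hd := delta_pos m t Hm); assert (Hs := sqrt_delta_pos m t Hm).
  assert (Hq := sqrt_sqrt _ (Rlt_le _ _ Hd)).
  set (q := sqrt _) in *.
  change (/ (2 * m) * (q - 1 / q) = - sin t ^ 2 * (1 / q / 2)).
  (* Eliminating the sine leaves a rational identity in [q] and [m]. *)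
  replace (sin t ^ 2) with ((1 - q * q) / m) by (rewrite Hq; field; trivial).
  field; lra.
- replace ((parE m - parK m) / (2 * m)) with
    (scal (/ (2 * m)) (minus (parE m) (parK m)))
    by (unfold scal, minus, plus, opp; simpl; unfold mult; simpl; field; trivial).
  apply: is_RInt_scal; apply: is_RInt_minus;
    [now apply is_RInt_parE | now apply is_RInt_parK].
Qed.

(** Here the integrands agree only up to a multiple of an exact derivative [dg], whose integral
    vanishes because its primitive [g] is zero at both [0] and [PI / 2]. *)
Lemma is_derive_parK (m : R) : m < 1 -> m <> 0 ->
  is_derive parK m ((parE m - (1 - m) * parK m) / (2 * m * (1 - m))).
Proof.
intros Hm Hm0.
replace (_ / _) with (RInt (fun t => - sin t ^ 2 *
  (- / (2 * (1 - m * sin t ^ 2) * sqrt (1 - m * sin t ^ 2)))) 0 (PI / 2)).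
{ now apply is_derive_parK_RInt. }
apply is_RInt_unique.
set (g := fun t => sin t * cos t / sqrt (1 - m * sin t ^ 2)).
set (dg := fun t => (cos t ^ 2 - sin t ^ 2) / sqrt (1 - m * sin t ^ 2) +
   m * sin t ^ 2 * cos t ^ 2 /
     ((1 - m * sin t ^ 2) * sqrt (1 - m * sin t ^ 2))).
assert (Hg : is_RInt dg 0 (PI / 2) 0).
{ replace 0 with (minus (g (PI / 2)) (g 0)) at 2.
  2:{ unfold g; rewrite cos_PI2 sin_0.
      change (sin (PI / 2) * 0 / sqrt (1 - m * sin (PI / 2) ^ 2)
        - 0 * cos 0 / sqrt (1 - m * 0 ^ 2) = 0).
      unfold Rdiv; ring. }
  apply: is_RInt_derive => t _.
  - assert (Hd := delta_pos m t Hm); assert (Hs := sqrt_delta_pos m t Hm).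
    unfold g, dg; auto_derive.
    + change (1 + - (m * (sin t * (sin t * 1)))) with (1 - m * sin t ^ 2).
      repeat split; trivial; lra.
    + change (1 + - (m * (sin t * (sin t * 1)))) with (1 - m * sin t ^ 2).
      rewrite sqrt_sqrt; [field | ]; lra.
  - assert (Hd := delta_pos m t Hm); assert (Hs := sqrt_delta_pos m t Hm).
    apply: ex_derive_continuous; unfold dg; auto_derive.
    change (1 + - (m * (sin t * (sin t * 1)))) with (1 - m * sin t ^ 2).
    repeat split; trivial; nra. }
apply is_RInt_ext with (fun t => scal (/ (2 * m * (1 - m)))
  (minus (minus (sqrt (1 - m * sin t ^ 2))
     (scal (1 - m) (1 / sqrt (1 - m * sin t ^ 2)))) (scal m (dg t)))).
- intros t _.
  assert (Hd := delta_pos m t Hm); assert (Hs := sqrt_delta_pos m t Hm).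
  assert (Hq := sqrt_sqrt _ (Rlt_le _ _ Hd)).
  unfold dg; replace (cos t ^ 2) with (1 - sin t ^ 2)
    by (generalize (sin2_cos2 t); unfold Rsqr; lra).
  set (q := sqrt _) in *; rewrite -Hq.
  change (/ (2 * m * (1 - m)) * ((q - (1 - m) * (1 / q)) -
    m * ((1 - sin t ^ 2 - sin t ^ 2) / q +
       m * sin t ^ 2 * (1 - sin t ^ 2) / (q * q * q))) =
    - sin t ^ 2 * - / (2 * (q * q) * q)).
  replace (sin t ^ 2) with ((1 - q * q) / m) by (rewrite Hq; field; trivial).
  field; lra.
- replace ((parE m - (1 - m) * parK m) / (2 * m * (1 - m))) with
    (scal (/ (2 * m * (1 - m)))
    (minus (minus (parE m) (scal (1 - m) (parK m))) (scal m 0))).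
  + apply: is_RInt_scal; apply: is_RInt_minus.
    * apply: is_RInt_minus; [now apply is_RInt_parE | ].
      apply: is_RInt_scal; now apply is_RInt_parK.
    * now apply: is_RInt_scal.
  + unfold scal, minus, plus, opp; simpl; unfold mult; simpl; field; lra.
Qed.

(** * Positivity and comparison of the integrals, and a monotonicity criterion *)

Lemma parK_pos (m : R) : m < 1 -> 0 < parK m.
Proof.
intros Hm; apply RInt_gt_0.
- exact PI2_RGT_0.
- intros t _; apply Rdiv_lt_0_compat; [lra | now apply sqrt_delta_pos].
- intros t _; apply (continuous_delta_comp (fun w => 1 / sqrt w)); trivial.
  exact continuous_inv_sqrt.
Qed.

Lemma parE_pos (m : R) : m < 1 -> 0 < parE m.
Proof.
intros Hm; apply RInt_gt_0.
- exact PI2_RGT_0.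
- intros t _; now apply sqrt_delta_pos.
- intros t _; apply continuous_delta_comp; trivial.
  exact continuous_sqrt_pos.
Qed.

Lemma parE_lt_parK (m : R) : 0 < m < 1 -> parE m < parK m.
Proof.
intros Hm; apply RInt_lt.
- exact PI2_RGT_0.
- intros t _; apply (continuous_delta_comp (fun w => 1 / sqrt w)); [ | lra].
  exact continuous_inv_sqrt.
- intros t _; apply continuous_delta_comp; [ | lra].
  exact continuous_sqrt_pos.
- intros t Ht.
  assert (Hsin : 0 < sin t ^ 2).
  { apply pow_lt, sin_gt_0; lra. }
  assert (Hs := sqrt_delta_pos m t (proj2 Hm)).
  assert (Hd := delta_pos m t (proj2 Hm)).
  apply Rmult_lt_reg_r with (sqrt (1 - m * sin t ^ 2)); trivial.
  rewrite -> sqrt_sqrt by lra.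
  unfold Rdiv; rewrite -> Rmult_assoc, Rinv_l by lra.
  nra.
Qed.

Lemma parE_0_parK_0 : parE 0 = parK 0.
Proof.
apply RInt_ext => t _.
replace (1 - 0 * sin t ^ 2) with 1 by ring.
now rewrite sqrt_1 Rdiv_1_r.
Qed.

(* The integrand of [2 E - K] at [m = 1 / 2] is [cos ^ 2 / sqrt _]. *)
Lemma parK_lt_2parE : parK (1 / 2) < 2 * parE (1 / 2).
Proof.
apply Rlt_le_trans with (RInt (fun t => 2 * sqrt (1 - 1 / 2 * sin t ^ 2)) 0 (PI / 2)).
- apply RInt_lt.
  + exact PI2_RGT_0.
  + intros t _; apply (continuous_delta_comp (fun w => 2 * sqrt w)); [ | lra].
    intros w Hw; apply: continuous_scal_r; now apply continuous_sqrt_pos.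
  + intros t _; apply (continuous_delta_comp (fun w => 1 / sqrt w)); [ | lra].
    exact continuous_inv_sqrt.
  + intros t Ht.
    assert (Hm : 1 / 2 < 1) by lra.
    assert (Hcos : 0 < cos t ^ 2).
    { apply pow_lt, cos_gt_0; lra. }
    assert (Hs := sqrt_delta_pos _ t Hm).
    assert (Hd := delta_pos _ t Hm).
    assert (H1 := sin2_cos2 t); unfold Rsqr in H1.
    apply Rmult_lt_reg_r with (sqrt (1 - 1 / 2 * sin t ^ 2)); trivial.
    rewrite -> Rmult_assoc, sqrt_sqrt by lra.
    replace (1 / sqrt (1 - 1 / 2 * sin t ^ 2) * sqrt (1 - 1 / 2 * sin t ^ 2))
      with 1 by (field; lra).
    nra.
- right; apply is_RInt_unique; apply: is_RInt_scal; apply is_RInt_parE; lra.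
Qed.

(** Requiring only continuity at the endpoints lets the criterion reach [r = 0] for [psi_num] and
    [r = 1] for [psi_den], where the derivative formulas are not established. *)
Lemma derive_pos_lt (f df : R -> R) (a b : R) : a < b ->
  (forall x, a < x < b -> is_derive f x (df x)) ->
  (forall x, a <= x <= b -> continuity_pt f x) ->
  (forall x, a < x < b -> 0 < df x) -> f a < f b.
Proof.
intros Hab Hd Hc Hpos.
(* [MVT_gen] places its point in the closed interval, while [df] is controlled only inside; the
   value 1 elsewhere is an arbitrary positive default. *)
set (dg := fun x => match Rlt_dec a x with
  | left _ => match Rlt_dec x b with left _ => df x | right _ => 1 end
  | right _ => 1 end).
assert (Hdg : forall x, 0 < dg x).
{ intros x; unfold dg; destruct (Rlt_dec a x), (Rlt_dec x b); try lra; auto. }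
destruct (MVT_gen f a b dg) as [c [_ Hc']].
- rewrite -> Rmin_left, Rmax_right by lra.
  intros x Hx; unfold dg; destruct (Rlt_dec a x), (Rlt_dec x b); try lra; auto.
- rewrite -> Rmin_left, Rmax_right by lra; trivial.
- specialize (Hdg c); nra.
Qed.

(** * Derivatives and continuity in the modulus *)

Lemma is_derive_ellE (r : R) : 0 < r < 1 ->
  is_derive ellE r ((ellE r - ellK r) / r).
Proof.
intros Hr.
change (is_derive (fun r => parE (r ^ 2)) r ((parE (r ^ 2) - parK (r ^ 2)) / r)).
replace (_ / _) with (2 * r * ((parE (r ^ 2) - parK (r ^ 2)) / (2 * r ^ 2)))
  by (field; lra).
apply (is_derive_comp parE (fun r => r ^ 2)).
- apply is_derive_parE; nra.
- auto_derive; trivial; ring.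
Qed.

Lemma is_derive_ellK (r : R) : 0 < r < 1 ->
  is_derive ellK r ((ellE r - (1 - r ^ 2) * ellK r) / (r * (1 - r ^ 2))).
Proof.
intros Hr.
change (is_derive (fun r => parK (r ^ 2)) r
  ((parE (r ^ 2) - (1 - r ^ 2) * parK (r ^ 2)) / (r * (1 - r ^ 2)))).
replace (_ / _) with (2 * r * ((parE (r ^ 2) - (1 - r ^ 2) * parK (r ^ 2))
  / (2 * r ^ 2 * (1 - r ^ 2)))) by (field; split; nra).
apply (is_derive_comp parK (fun r => r ^ 2)).
- apply is_derive_parK; nra.
- auto_derive; trivial; ring.
Qed.

(* Unlike [ellK'] and [ellE'], these are smooth across [r = 1]. *)
Definition coK (r : R) : R := parK (1 - r ^ 2).
Definition coE (r : R) : R := parE (1 - r ^ 2).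

Lemma ellK'_coK (r : R) : 0 < r < 1 -> ellK' r = coK r.
Proof.
intros Hr; change (parK (sqrt (1 - r ^ 2) ^ 2) = coK r).
rewrite pow2_sqrt; [reflexivity | nra].
Qed.

Lemma ellE'_coE (r : R) : 0 < r < 1 -> ellE' r = coE r.
Proof.
intros Hr; change (parE (sqrt (1 - r ^ 2) ^ 2) = coE r).
rewrite pow2_sqrt; [reflexivity | nra].
Qed.

Lemma is_derive_coE (r : R) : 0 < r < 1 ->
  is_derive coE r (r * (coK r - coE r) / (1 - r ^ 2)).
Proof.
intros Hr; unfold coE, coK.
replace (_ / _) with (- 2 * r * ((parE (1 - r ^ 2) - parK (1 - r ^ 2))
  / (2 * (1 - r ^ 2)))) by (field; nra).
apply (is_derive_comp parE (fun r => 1 - r ^ 2)).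
- apply is_derive_parE; nra.
- auto_derive; trivial; ring.
Qed.

Lemma is_derive_coK (r : R) : 0 < r < 1 ->
  is_derive coK r (- (coE r - r ^ 2 * coK r) / (r * (1 - r ^ 2))).
Proof.
intros Hr; unfold coE, coK.
replace (_ / _) with (- 2 * r *
  ((parE (1 - r ^ 2) - (1 - (1 - r ^ 2)) * parK (1 - r ^ 2))
  / (2 * (1 - r ^ 2) * (1 - (1 - r ^ 2))))) by (field; split; nra).
apply (is_derive_comp parK (fun r => 1 - r ^ 2)).
- apply is_derive_parK; nra.
- auto_derive; trivial; ring.
Qed.

Lemma continuous_parE_comp (g : R -> R) (x : R) :
  continuous g x -> g x < 1 -> continuous (fun x => parE (g x)) x.
Proof.
intros Hg Hx; apply (continuous_comp g parE); trivial.
apply: ex_derive_continuous; eexists; now apply is_derive_parE_RInt.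
Qed.

Lemma continuous_parK_comp (g : R -> R) (x : R) :
  continuous g x -> g x < 1 -> continuous (fun x => parK (g x)) x.
Proof.
intros Hg Hx; apply (continuous_comp g parK); trivial.
apply: ex_derive_continuous; eexists; now apply is_derive_parK_RInt.
Qed.

Lemma continuous_ellE (r : R) : -1 < r < 1 -> continuous ellE r.
Proof.
intros Hr; apply (continuous_parE_comp (fun r => r ^ 2)); [ | nra].
apply: ex_derive_continuous; now auto_derive.
Qed.

Lemma continuous_ellK (r : R) : -1 < r < 1 -> continuous ellK r.
Proof.
intros Hr; apply (continuous_parK_comp (fun r => r ^ 2)); [ | nra].
apply: ex_derive_continuous; now auto_derive.
Qed.

Lemma continuous_coE (r : R) : 0 < r -> continuous coE r.
Proof.
intros Hr; apply (continuous_parE_comp (fun r => 1 - r ^ 2)); [ | nra].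
apply: ex_derive_continuous; now auto_derive.
Qed.

Lemma continuous_coK (r : R) : 0 < r -> continuous coK r.
Proof.
intros Hr; apply (continuous_parK_comp (fun r => 1 - r ^ 2)); [ | nra].
apply: ex_derive_continuous; now auto_derive.
Qed.

(** * Numerator and denominator of [psi] *)

Definition psi_num (r : R) : R := ellE r - (1 - r) * ellK r.
Definition psi_den (r : R) : R := coE r - r * coK r.

Lemma psi_num_den (r : R) : 0 < r < 1 -> psi r = 2 * psi_num r / psi_den r.
Proof.
intros Hr; unfold psi; now rewrite ellE'_coE // ellK'_coK.
Qed.

Lemma continuity_pt_psi_num (r : R) : -1 < r < 1 -> continuity_pt psi_num r.
Proof.
intros Hr; apply continuity_pt_minus; [ | apply continuity_pt_mult].
- now apply continuity_pt_filterlim, continuous_ellE.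
- apply derivable_continuous_pt; reg.
- now apply continuity_pt_filterlim, continuous_ellK.
Qed.

Lemma continuity_pt_psi_den (r : R) : 0 < r -> continuity_pt psi_den r.
Proof.
intros Hr; apply continuity_pt_minus; [ | apply continuity_pt_mult].
- now apply continuity_pt_filterlim, continuous_coE.
- apply derivable_continuous_pt; reg.
- now apply continuity_pt_filterlim, continuous_coK.
Qed.

(* The integrals are generalized first, lest [auto_derive] unfold them. *)
Ltac auto_derive_elliptic r Hr :=
  generalize (is_derive_ellE r Hr) (is_derive_ellK r Hr)
    (is_derive_coE r Hr) (is_derive_coK r Hr);
  generalize ellE ellK coE coK;
  let E := fresh "E" in let K := fresh "K" in
  let E1 := fresh "E1" in let K1 := fresh "K1" in
  let HE := fresh in let HK := fresh in let HE1 := fresh in let HK1 := fresh in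
  intros E K E1 K1 HE HK HE1 HK1;
  auto_derive;
  [ repeat split; eexists; eassumption
  | rewrite ?(is_derive_unique _ _ _ HE) ?(is_derive_unique _ _ _ HK)
      ?(is_derive_unique _ _ _ HE1) ?(is_derive_unique _ _ _ HK1) ].

(** The weight [1 - r] cancels against [1 - r ^ 2], after which all [ellK] terms drop out. *)
Lemma is_derive_psi_num (r : R) : 0 < r < 1 ->
  is_derive psi_num r (ellE r / (1 + r)).
Proof.
intros Hr; unfold psi_num; auto_derive_elliptic r Hr.
field; nra.
Qed.

Lemma is_derive_psi_den (r : R) : 0 < r < 1 ->
  is_derive psi_den r (- (coK r - coE r) / (1 + r)).
Proof.
intros Hr; unfold psi_den; auto_derive_elliptic r Hr.
field; nra.
Qed.

Lemma ellE_pos (r : R) : 0 < r < 1 -> 0 < ellE r.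
Proof. intros Hr; apply (parE_pos (r ^ 2)); nra. Qed.

Lemma coK_pos (r : R) : 0 < r -> 0 < coK r.
Proof. intros Hr; apply parK_pos; nra. Qed.

Lemma coE_pos (r : R) : 0 < r -> 0 < coE r.
Proof. intros Hr; apply parE_pos; nra. Qed.

Lemma coE_lt_coK (r : R) : 0 < r < 1 -> coE r < coK r.
Proof. intros Hr; apply parE_lt_parK; nra. Qed.

Lemma ellE_0_ellK_0 : ellE 0 = ellK 0.
Proof.
change (parE (0 ^ 2) = parK (0 ^ 2)); replace (0 ^ 2) with 0 by ring.
exact parE_0_parK_0.
Qed.

Lemma coE_1_coK_1 : coE 1 = coK 1.
Proof.
unfold coE, coK; replace (1 - 1 ^ 2) with 0 by ring; exact parE_0_parK_0.
Qed.

Lemma psi_num_0 : psi_num 0 = 0.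
Proof. unfold psi_num; rewrite ellE_0_ellK_0; ring. Qed.

Lemma psi_den_1 : psi_den 1 = 0.
Proof. unfold psi_den; rewrite coE_1_coK_1; ring. Qed.

Lemma psi_num_lt (r s : R) : 0 <= r -> r < s -> s < 1 -> psi_num r < psi_num s.
Proof.
intros Hr Hrs Hs.
apply (derive_pos_lt psi_num (fun r => ellE r / (1 + r))); trivial.
- intros x Hx; apply is_derive_psi_num; lra.
- intros x Hx; apply continuity_pt_psi_num; lra.
- intros x Hx; apply Rdiv_lt_0_compat; [apply ellE_pos | ]; lra.
Qed.

Lemma psi_den_lt (r s : R) : 0 < r -> r < s -> s <= 1 -> psi_den s < psi_den r.
Proof.
intros Hr Hrs Hs; apply Ropp_lt_cancel.
apply (derive_pos_lt (fun r => - psi_den r) (fun r => (coK r - coE r) / (1 + r)));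
  trivial.
- intros x Hx; replace (_ / _) with (opp (- (coK x - coE x) / (1 + x)))
    by (unfold opp; simpl; field; lra).
  apply: is_derive_opp; apply is_derive_psi_den; lra.
- intros x Hx; apply continuity_pt_opp, continuity_pt_psi_den; lra.
- intros x Hx; assert (H := coE_lt_coK x ltac:(lra)).
  apply Rdiv_lt_0_compat; lra.
Qed.

Lemma psi_num_pos (r : R) : 0 < r < 1 -> 0 < psi_num r.
Proof. intros Hr; rewrite -psi_num_0; apply psi_num_lt; lra. Qed.

Lemma psi_den_pos (r : R) : 0 < r < 1 -> 0 < psi_den r.
Proof. intros Hr; rewrite -psi_den_1; apply psi_den_lt; lra. Qed.

(** * Range of [psi] *)

Lemma psi_pos (r : R) : 0 < r < 1 -> 0 < psi r.
Proof.
intros Hr; rewrite psi_num_den //.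
assert (Hn := psi_num_pos r Hr); assert (Hd := psi_den_pos r Hr).
apply Rdiv_lt_0_compat; lra.
Qed.

(** The intermediate value theorem is applied to [2 * psi_num - y * psi_den] instead of [psi], so
    that only the zero of the numerator at 0 and that of the denominator at 1 are needed. *)
Lemma psi_surj (y : R) : 0 < y -> exists r, 0 < r < 1 /\ psi r = y.
Proof.
intros Hy.
assert (Hn := psi_num_pos (1 / 2) ltac:(lra)).
assert (Hd := psi_den_pos (1 / 2) ltac:(lra)).
set (h := fun r => 2 * psi_num r - y * psi_den r).
(* Near 0 the numerator is small, while the decreasing denominator stays above its value at
   [1 / 2]. *)
assert (Hr1 : exists r1, 0 < r1 < 1 / 2 /\ h r1 < 0).
{ assert (Hc := proj1 (continuity_pt_filterlim _ _)
    (continuity_pt_psi_num 0 ltac:(lra))).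
  rewrite psi_num_0 in Hc.
  destruct (Hc (fun v => v < y * psi_den (1 / 2) / 2)) as [e He].
  - apply open_lt, Rdiv_lt_0_compat; nra.
  (* Within the continuity radius [e] of 0, and below [1 / 2]. *)
  - exists (Rmin (e / 2) (1 / 4)).
    assert (He0 := cond_pos e).
    assert (H0 : 0 < Rmin (e / 2) (1 / 4)) by (apply Rmin_pos; lra).
    assert (H1 := Rmin_l (e / 2) (1 / 4)); assert (H2 := Rmin_r (e / 2) (1 / 4)).
    split; [lra | ].
    assert (Hlt := psi_den_lt _ (1 / 2) H0 ltac:(lra) ltac:(lra)).
    assert (Hnum := He (Rmin (e / 2) (1 / 4))).
    unfold h.
    assert (psi_num (Rmin (e / 2) (1 / 4)) < y * psi_den (1 / 2) / 2).
    { apply Hnum; change (Rabs (Rmin (e / 2) (1 / 4) - 0) < e).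
      rewrite Rminus_0_r Rabs_pos_eq; lra. }
    nra. }
(* Symmetrically, near 1 the denominator is small and the numerator exceeds its value at [1 / 2]. *)
assert (Hr2 : exists r2, 1 / 2 < r2 < 1 /\ 0 < h r2).
{ assert (Hc := proj1 (continuity_pt_filterlim _ _)
    (continuity_pt_psi_den 1 ltac:(lra))).
  rewrite psi_den_1 in Hc.
  destruct (Hc (fun v => v < 2 * psi_num (1 / 2) / y)) as [e He].
  - apply open_lt, Rdiv_lt_0_compat; nra.
  - exists (1 - Rmin (e / 2) (1 / 4)).
    assert (He0 := cond_pos e).
    assert (H0 : 0 < Rmin (e / 2) (1 / 4)) by (apply Rmin_pos; lra).
    assert (H1 := Rmin_l (e / 2) (1 / 4)); assert (H2 := Rmin_r (e / 2) (1 / 4)).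
    split; [lra | ].
    assert (Hlt := psi_num_lt (1 / 2) (1 - Rmin (e / 2) (1 / 4))
      ltac:(lra) ltac:(lra) ltac:(lra)).
    assert (Hden := He (1 - Rmin (e / 2) (1 / 4))).
    unfold h.
    assert (H : psi_den (1 - Rmin (e / 2) (1 / 4)) < 2 * psi_num (1 / 2) / y).
    { apply Hden; change (Rabs (1 - Rmin (e / 2) (1 / 4) - 1) < e).
      rewrite Rabs_left; lra. }
    apply (Rmult_lt_compat_l y) in H; trivial.
    replace (y * (2 * psi_num (1 / 2) / y)) with (2 * psi_num (1 / 2)) in H
      by (field; lra).
    lra. }
destruct Hr1 as [r1 [Hr1 Hh1]]; destruct Hr2 as [r2 [Hr2 Hh2]].
destruct (IVT_interv h r1 r2) as [r [Hr Hhr]]; trivial; [ | lra | ].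
- intros a Ha; apply continuity_pt_minus; apply continuity_pt_scal.
  + apply continuity_pt_psi_num; lra.
  + apply continuity_pt_psi_den; lra.
- exists r; split; [lra | ].
  rewrite psi_num_den; [ | lra].
  assert (Hdr := psi_den_pos r ltac:(lra)).
  unfold h in Hhr; field_simplify_eq; lra.
Qed.

(* Legendre's relation says that this equals [PI / 2]; only its constancy and
   positivity matter here. *)
Definition legendre (r : R) : R :=
  ellE r * coK r + ellK r * coE r - ellK r * coK r.

(** * Constancy of the Legendre combination and the derivative of [psi] *)

Lemma is_derive_legendre (r : R) : 0 < r < 1 -> is_derive legendre r 0.
Proof.
intros Hr; unfold legendre; auto_derive_elliptic r Hr.
field; nra.
Qed.

Lemma legendre_const (r s : R) : 0 < r < 1 -> 0 < s < 1 ->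
  legendre r = legendre s.
Proof.
intros Hr Hs.
assert (Hin : forall x, Rmin r s <= x <= Rmax r s -> 0 < x < 1).
{ intros x; unfold Rmin, Rmax; destruct (Rle_dec r s); lra. }
destruct (MVT_gen legendre r s (fun _ => 0)) as [c [_ Hc]].
- intros x Hx; apply is_derive_legendre, Hin; lra.
- intros x Hx; apply continuity_pt_filterlim; apply: ex_derive_continuous.
  exists 0; now apply is_derive_legendre, Hin.
- lra.
Qed.

(** By constancy it is enough to look at the self-complementary modulus [sqrt (1 / 2)], where the
    combination becomes [K * (2 * E - K)] at parameter [1 / 2]. *)
Lemma legendre_pos (r : R) : 0 < r < 1 -> 0 < legendre r.
Proof.
intros Hr.
assert (Hs : sqrt (1 / 2) ^ 2 = 1 / 2) by (apply pow2_sqrt; lra).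
assert (Hs0 : 0 < sqrt (1 / 2)) by (apply sqrt_lt_R0; lra).
rewrite (legendre_const r (sqrt (1 / 2))) //; [ | nra].
unfold legendre, coK, coE.
change (ellK (sqrt (1 / 2))) with (parK (sqrt (1 / 2) ^ 2)).
change (ellE (sqrt (1 / 2))) with (parE (sqrt (1 / 2) ^ 2)).
rewrite Hs; replace (1 - 1 / 2) with (1 / 2) by lra.
assert (HK := parK_pos (1 / 2) ltac:(lra)); assert (H := parK_lt_2parE).
nra.
Qed.

(** In the quotient rule the [ellE r * coE r] terms cancel, and the rest factors as
    [(1 - r) * legendre r]. *)
Lemma is_derive_psi (r : R) : 0 < r < 1 ->
  is_derive psi r (2 * (1 - r) * legendre r / ((1 + r) * psi_den r ^ 2)).
Proof.
intros Hr.
apply (is_derive_ext_loc (fun r => 2 * psi_num r / psi_den r)).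
- assert (Hl : locally r (fun r => 0 < r /\ r < 1)).
  { apply filter_and; [apply open_gt | apply open_lt]; apply Hr. }
  apply: filter_imp Hl => s Hs; symmetry; now apply psi_num_den.
- assert (Hd := psi_den_pos r Hr).
  replace (_ / _) with
    ((2 * (ellE r / (1 + r)) * psi_den r -
      2 * psi_num r * (- (coK r - coE r) / (1 + r))) / psi_den r ^ 2).
  2:{ field_simplify_eq; [ | lra].
      unfold legendre, psi_den, psi_num; ring. }
  apply (is_derive_div (fun r => 2 * psi_num r)); [ | | lra].
  + now apply (is_derive_scal psi_num), is_derive_psi_num.
  + now apply is_derive_psi_den.
Qed.

(* Up to a positive factor, the logarithmic derivative of [slope_sq] below. *)
Definition barrier (r : R) : R :=
  (1 - 4 * r) * coE r + r * (1 + 2 * r ^ 2) * coK r.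

(** * Positivity of the barrier *)

Lemma is_derive_barrier (r : R) : 0 < r < 1 ->
  is_derive barrier r
    ((- (5 + 6 * r) * coE r + (1 + 2 * r + 4 * r ^ 2 + 4 * r ^ 3) * coK r) / (1 + r)).
Proof.
intros Hr; unfold barrier; auto_derive_elliptic r Hr.
field; nra.
Qed.

Lemma barrier_1 : barrier 1 = 0.
Proof. unfold barrier; rewrite coE_1_coK_1; ring. Qed.

Lemma continuity_pt_barrier (r : R) : 0 < r -> continuity_pt barrier r.
Proof.
intros Hr; apply continuity_pt_plus; apply continuity_pt_mult.
- apply derivable_continuous_pt; reg.
- now apply continuity_pt_filterlim, continuous_coE.
- apply derivable_continuous_pt; reg.
- now apply continuity_pt_filterlim, continuous_coK.
Qed.

(* Where the barrier is nonpositive, [coK] is at most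
   [(4 r - 1) / (r (1 + 2 r ^ 2)) * coE], and inserting this in the derivative
   leaves a negative multiple of
   [(1 - r) * (1 + 4 * r + 6 * r ^ 2 + 4 * r ^ 3)]. *)
Lemma barrier_derive_neg (r : R) : 0 < r < 1 -> barrier r <= 0 ->
  (- (5 + 6 * r) * coE r + (1 + 2 * r + 4 * r ^ 2 + 4 * r ^ 3) * coK r) / (1 + r) < 0.
Proof.
intros Hr; unfold barrier; intros H.
assert (HE := coE_pos r (proj1 Hr)).
set (E := coE r) in *; set (K := coK r) in *.
assert (Hr2 : 0 < r ^ 2) by (apply pow_lt; lra).
assert (Hr3 : 0 < r ^ 3) by (apply pow_lt; lra).
assert (HB : 0 < r * (1 + 2 * r ^ 2)) by nra.
(* Scaling by the coefficient of [K] in the derivative allows [K] to be eliminated linearly. *)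
assert (H1 : (1 + 2 * r + 4 * r ^ 2 + 4 * r ^ 3) *
  ((1 - 4 * r) * E + r * (1 + 2 * r ^ 2) * K) <= 0) by nra.
assert (H2 : 0 < E * ((1 - r) * (1 + 4 * r + 6 * r ^ 2 + 4 * r ^ 3))).
{ apply Rmult_lt_0_compat; [ | apply Rmult_lt_0_compat]; lra. }
assert (Hneg : - (5 + 6 * r) * E + (1 + 2 * r + 4 * r ^ 2 + 4 * r ^ 3) * K < 0).
{ apply Rmult_lt_reg_l with (r * (1 + 2 * r ^ 2)); trivial; lra. }
unfold Rdiv; assert (Hi : 0 < / (1 + r)) by (apply Rinv_0_lt_compat; lra).
nra.
Qed.

Lemma barrier_pos (r : R) : 0 < r < 1 -> 0 < barrier r.
Proof.
(* Up to [1 / 4] the coefficient [1 - 4 * s] is nonnegative. *)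
assert (Hsmall : forall s, 0 < s <= 1 / 4 -> 0 < barrier s).
{ intros s Hs; unfold barrier.
  assert (HE := coE_pos s (proj1 Hs)); assert (HK := coK_pos s (proj1 Hs)).
  assert (0 < s * (1 + 2 * s ^ 2) * coK s)
    by (repeat apply Rmult_lt_0_compat; nra).
  nra. }
intros Hr; destruct (Rlt_le_dec 0 (barrier r)) as [ | Hle]; trivial; exfalso.
assert (Hr4 : 1 / 4 < r).
{ destruct (Rlt_le_dec (1 / 4) r) as [ | H]; trivial.
  specialize (Hsmall r); lra. }
assert (Hmin : exists s, 1 / 4 < s < 1 /\ barrier s <= 0 /\
  forall x, 1 / 4 < x -> x < 1 -> barrier s <= barrier x).
{ destruct (continuity_ab_min barrier (1 / 4) 1) as [s [Hs Hs1]]; [lra | | ].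
  - intros c Hc; apply continuity_pt_barrier; lra.
  - assert (Hsr := Hs r ltac:(lra)).
    destruct (Rlt_le_dec s 1) as [Hlt | Hge].
    + exists s; repeat split; trivial; try lra.
      * destruct (Rlt_le_dec (1 / 4) s) as [ | H]; trivial.
        specialize (Hsmall s); lra.
      * intros x Hx Hx1; apply Hs; lra.
    (* If the minimum is attained at 1 its value is 0, so [barrier r <= 0] makes [r] itself an
       interior minimizer. *)
    + replace s with 1 in * by lra; rewrite barrier_1 in Hs Hsr.
      exists r; repeat split; trivial; try lra.
      intros x Hx Hx1; specialize (Hs x); lra. }
destruct Hmin as [s [Hs [Hle' Hmin]]].
assert (Hd := is_derive_barrier s ltac:(lra)).
assert (Hn := barrier_derive_neg s ltac:(lra) Hle').
apply is_derive_Reals in Hd.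
assert (H0 := deriv_minimum barrier (1 / 4) 1 s (exist (derivable_pt_abs barrier s) _ Hd)
  (proj1 Hs) (proj2 Hs) Hmin).
simpl in H0; lra.
Qed.

(* With [r = 1 / cosh x], the squared derivative of [psi (1 / cosh x)] is
   [4 * legendre r ^ 2 * slope_sq r]; squaring removes [sqrt (1 - r ^ 2)]. *)
Definition slope_sq (r : R) : R :=
  r ^ 2 * (1 - r) ^ 3 / ((1 + r) * psi_den r ^ 4).

(** * Monotonicity of the squared slope *)

(** The logarithmic derivative is [2 / r - 3 / (1 - r) - 1 / (1 + r) - 4 * D' / D] with
    [D = psi_den]; over a common denominator its numerator is twice the barrier. *)
Lemma is_derive_slope_sq (r : R) : 0 < r < 1 ->
  is_derive slope_sq r
    (slope_sq r * (2 * barrier r / (r * (1 - r ^ 2) * psi_den r))).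
Proof.
intros Hr; assert (Hd := psi_den_pos r Hr).
assert (HD := is_derive_psi_den r Hr).
unfold slope_sq, barrier.
assert (HE : psi_den r = coE r - r * coK r) by reflexivity.
revert Hd HD HE; generalize psi_den (coE r) (coK r); intros D E K Hd HD HE.
auto_derive.
- split; [eexists; exact HD | split; trivial].
  apply Rgt_not_eq; repeat apply Rmult_lt_0_compat; lra.
- rewrite (is_derive_unique _ _ _ HD).
  field_simplify_eq; [ | nra].
  rewrite HE; ring.
Qed.

Lemma slope_sq_lt (r s : R) : 0 < r -> r < s -> s < 1 -> slope_sq r < slope_sq s.
Proof.
intros Hr Hrs Hs.
eapply (derive_pos_lt slope_sq); trivial.
- intros x Hx; apply is_derive_slope_sq; lra.
- intros x Hx; apply continuity_pt_filterlim; apply: ex_derive_continuous.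
  eexists; apply is_derive_slope_sq; lra.
- intros x Hx; assert (Hx1 : 0 < x < 1) by lra.
  assert (Hd := psi_den_pos x Hx1); assert (Hb := barrier_pos x Hx1).
  assert (0 < 1 - x ^ 2) by nra.
  unfold slope_sq.
  apply Rmult_lt_0_compat; apply Rdiv_lt_0_compat;
    repeat apply Rmult_lt_0_compat; try apply pow_lt; lra.
Qed.

(** * The substitution [r = 1 / cosh x] *)

Lemma cosh_sq (x : R) : cosh x ^ 2 = 1 + sinh x ^ 2.
Proof.
assert (H : exp x * exp (- x) = 1) by (rewrite -exp_plus Rplus_opp_r; exact exp_0).
unfold cosh, sinh; nra.
Qed.

Lemma sinh_pos (x : R) : 0 < x -> 0 < sinh x.
Proof.
intros Hx; unfold sinh.
assert (exp (- x) < exp x) by (apply exp_increasing; lra); lra.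
Qed.

Lemma cosh_pos (x : R) : 0 < cosh x.
Proof.
unfold cosh; assert (H := exp_pos x); assert (H1 := exp_pos (- x)); lra.
Qed.

Lemma inv_cosh_bound (x : R) : 0 < x -> 0 < 1 / cosh x < 1.
Proof.
intros Hx; assert (Hs := sinh_pos x Hx); assert (Hc := cosh_pos x).
assert (H := cosh_sq x).
split; [apply Rdiv_lt_0_compat; lra | ].
apply Rmult_lt_reg_r with (cosh x); trivial.
unfold Rdiv; rewrite -> Rmult_assoc, Rinv_l by lra; nra.
Qed.

Lemma is_derive_inv_cosh (x : R) :
  is_derive (fun x => 1 / cosh x) x (- sinh x / cosh x ^ 2).
Proof.
assert (Hc := cosh_pos x).
replace (- sinh x / cosh x ^ 2) with ((0 * cosh x - 1 * sinh x) / cosh x ^ 2)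
  by (field; lra).
apply is_derive_div; [ | | lra].
- apply: is_derive_const.
- apply is_derive_Reals, derivable_pt_lim_cosh.
Qed.

Lemma inv_cosh_lt (x y : R) : 0 < x -> x < y -> 1 / cosh y < 1 / cosh x.
Proof.
intros Hx Hxy.
apply Ropp_lt_cancel.
apply (derive_pos_lt (fun x => - (1 / cosh x)) (fun x => sinh x / cosh x ^ 2)); trivial.
- intros z _; replace (sinh z / cosh z ^ 2) with (opp (- sinh z / cosh z ^ 2))
    by (unfold opp; simpl; unfold Rdiv; ring).
  apply: is_derive_opp; apply is_derive_inv_cosh.
- intros z _; apply (continuity_pt_opp (fun z => 1 / cosh z)).
  apply derivable_continuous_pt, ex_derive_Reals_0.
  eexists; apply is_derive_inv_cosh.
- intros z Hz; apply Rdiv_lt_0_compat; [apply sinh_pos; lra | ].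
  apply pow_lt, cosh_pos.
Qed.

Lemma inv_cosh_surj (r : R) : 0 < r < 1 -> exists x, 0 < x /\ 1 / cosh x = r.
Proof.
intros Hr.
assert (H2 : 0 < 1 - r ^ 2) by nra.
assert (Hs := sqrt_lt_R0 _ H2); assert (Hq := sqrt_sqrt _ (Rlt_le _ _ H2)).
set (q := sqrt _) in *.
assert (Hz : 0 < (1 + q) / r) by (apply Rdiv_lt_0_compat; lra).
(* The logarithmic formula for the inverse hyperbolic cosine of [1 / r]. *)
exists (ln ((1 + q) / r)); split.
- rewrite -ln_1; apply ln_increasing; [lra | ].
  apply Rmult_lt_reg_r with r; [lra | ].
  unfold Rdiv; rewrite -> Rmult_assoc, Rinv_l by lra; lra.
- unfold cosh; rewrite -> exp_Ropp, exp_ln by trivial.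
  (* Holds because [(1 + q) * (1 - q) = r ^ 2]. *)
  replace (/ ((1 + q) / r)) with ((1 - q) / r); [field; lra | ].
  field_simplify_eq; [ | lra]; nra.
Qed.

(** * Monotonicity and convexity of the composite function *)

Definition psi_sech (x : R) : R := psi (1 / cosh x).

(** The derivative with its sign reversed: being positive, such slopes can be compared through their
    squares. *)
Definition psi_sech_slope (x : R) : R :=
  2 * (1 - 1 / cosh x) * legendre (1 / cosh x) * sinh x /
  ((1 + 1 / cosh x) * psi_den (1 / cosh x) ^ 2 * cosh x ^ 2).

Lemma is_derive_psi_sech (x : R) : 0 < x ->
  is_derive psi_sech x (- psi_sech_slope x).
Proof.
intros Hx; unfold psi_sech.
assert (Hr := inv_cosh_bound x Hx); assert (Hd := psi_den_pos _ Hr).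
assert (Hc := cosh_pos x).
replace (- psi_sech_slope x) with (- sinh x / cosh x ^ 2 *
  (2 * (1 - 1 / cosh x) * legendre (1 / cosh x) /
    ((1 + 1 / cosh x) * psi_den (1 / cosh x) ^ 2))).
- apply (is_derive_comp psi (fun x => 1 / cosh x)).
  + now apply is_derive_psi.
  + apply is_derive_inv_cosh.
- unfold psi_sech_slope; set (r := 1 / cosh x) in *; field.
  repeat split; lra.
Qed.

Lemma psi_sech_slope_pos (x : R) : 0 < x -> 0 < psi_sech_slope x.
Proof.
intros Hx; unfold psi_sech_slope.
assert (Hr := inv_cosh_bound x Hx); assert (Hd := psi_den_pos _ Hr).
assert (Hl := legendre_pos _ Hr).
assert (Hc := cosh_pos x); assert (Hs := sinh_pos x Hx).
revert Hr Hd Hl Hc Hs.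
generalize (legendre (1 / cosh x)) (psi_den (1 / cosh x)) (1 / cosh x) (cosh x) (sinh x).
intros l d r c s Hr Hd Hl Hc Hs.
apply Rdiv_lt_0_compat; repeat apply Rmult_lt_0_compat; lra.
Qed.

Lemma psi_sech_slope_sq (x : R) : 0 < x ->
  psi_sech_slope x ^ 2 = 4 * legendre (1 / cosh x) ^ 2 * slope_sq (1 / cosh x).
Proof.
intros Hx; unfold psi_sech_slope, slope_sq.
assert (Hr := inv_cosh_bound x Hx); assert (Hd := psi_den_pos _ Hr).
assert (Hc := cosh_pos x); assert (Hq := cosh_sq x).
set (r := 1 / cosh x) in *.
assert (Hcr : cosh x = 1 / r) by (unfold r; field; lra).
assert (Hs : sinh x ^ 2 = (1 - r ^ 2) / r ^ 2).
{ replace (sinh x ^ 2) with (cosh x ^ 2 - 1) by lra; rewrite Hcr; field; lra. }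
transitivity (4 * (1 - r) ^ 2 * legendre r ^ 2 * sinh x ^ 2 /
  ((1 + r) ^ 2 * psi_den r ^ 4 * cosh x ^ 4)).
- field; repeat split; lra.
- rewrite Hs Hcr; field; repeat split; lra.
Qed.

(** Since [legendre] is constant, the squares compare as [slope_sq] does, which increases in [r]
    while [r = 1 / cosh x] decreases in [x]. *)
Lemma psi_sech_slope_lt (x y : R) : 0 < x -> x < y ->
  psi_sech_slope y < psi_sech_slope x.
Proof.
intros Hx Hxy.
assert (Hrx := inv_cosh_bound x Hx); assert (Hry := inv_cosh_bound y ltac:(lra)).
assert (Hlt := inv_cosh_lt x y Hx Hxy).
assert (Hg := slope_sq_lt _ _ (proj1 Hry) Hlt (proj2 Hrx)).
assert (Hsx := psi_sech_slope_sq x Hx).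
assert (Hsy := psi_sech_slope_sq y ltac:(lra)).
rewrite (legendre_const _ _ Hry Hrx) in Hsy.
assert (Hl := pow_lt _ 2 (legendre_pos _ Hrx)).
assert (Hpx := psi_sech_slope_pos x Hx).
assert (Hpy := psi_sech_slope_pos y ltac:(lra)).
nra.
Qed.

Lemma psi_sech_lt (x y : R) : 0 < x -> x < y -> psi_sech y < psi_sech x.
Proof.
intros Hx Hxy.
destruct (MVT_cor2 psi_sech (fun x => - psi_sech_slope x) x y Hxy) as [c [Hc Hxc]].
- intros c Hc; apply is_derive_Reals, is_derive_psi_sech; lra.
- assert (H := psi_sech_slope_pos c ltac:(lra)); nra.
Qed.

(** Mean value slopes on the two sides of [z] are compared; the convexity gap is their difference
    times [t * (1 - t) * (y - x)]. *)
Lemma psi_sech_strict_convex (x y t : R) : 0 < x -> x < y -> 0 < t < 1 ->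
  psi_sech (t * x + (1 - t) * y) < t * psi_sech x + (1 - t) * psi_sech y.
Proof.
intros Hx Hxy Ht; set (z := t * x + (1 - t) * y).
assert (Hd : forall c, 0 < c -> derivable_pt_lim psi_sech c (- psi_sech_slope c)).
{ intros c Hc; now apply is_derive_Reals, is_derive_psi_sech. }
assert (Hxz : x < z) by (unfold z; nra).
assert (Hzy : z < y) by (unfold z; nra).
destruct (MVT_cor2 psi_sech (fun x => - psi_sech_slope x) x z Hxz) as [c [Hc Hxc]].
{ intros c Hc; apply Hd; lra. }
destruct (MVT_cor2 psi_sech (fun x => - psi_sech_slope x) z y Hzy) as [d [Hd' Hzd]].
{ intros d Hd'; apply Hd; lra. }
assert (Hlt := psi_sech_slope_lt c d ltac:(lra) ltac:(lra)).
replace (z - x) with ((1 - t) * (y - x)) in Hc by (unfold z; ring).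
replace (y - z) with (t * (y - x)) in Hd' by (unfold z; ring).
assert (Hpos : 0 < t * (1 - t) * (y - x)).
{ repeat apply Rmult_lt_0_compat; lra. }
nra.
Qed.

(** * The midpoint expressed through the moduli *)

Lemma comodulus_inv_cosh (x : R) : 0 < x -> comodulus (1 / cosh x) = sinh x / cosh x.
Proof.
intros Hx; assert (Hc := cosh_pos x); assert (Hs := sinh_pos x Hx).
assert (Hq := cosh_sq x).
unfold comodulus; replace (1 - (1 / cosh x) ^ 2) with ((sinh x / cosh x) ^ 2).
- rewrite sqrt_pow2 //; apply Rlt_le, Rdiv_lt_0_compat; lra.
- field_simplify_eq; lra.
Qed.

(** Combines the addition and double-argument formulas; in terms of [exp (x / 2)] and [exp (y / 2)]
    it is a rational identity. *)
Lemma cosh_half_sum (x y : R) :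
  2 * cosh ((x + y) / 2) ^ 2 = 1 + cosh x * cosh y + sinh x * sinh y.
Proof.
unfold cosh, sinh.
replace (exp ((x + y) / 2)) with (exp (x / 2) * exp (y / 2))
  by (rewrite -exp_plus; f_equal; field).
replace (exp (- ((x + y) / 2))) with (exp (- (x / 2)) * exp (- (y / 2)))
  by (rewrite -exp_plus; f_equal; field).
assert (Hdouble : forall z, exp z = exp (z / 2) ^ 2).
{ intros z; replace z with (z / 2 + z / 2) at 1 by field.
  rewrite exp_plus; ring. }
rewrite (Hdouble x) (Hdouble y) (Hdouble (- x)) (Hdouble (- y)).
replace (- x / 2) with (- (x / 2)) by field.
replace (- y / 2) with (- (y / 2)) by field.
rewrite !exp_Ropp.
assert (Ha := exp_pos (x / 2)); assert (Hb := exp_pos (y / 2)).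
field; lra.
Qed.

Lemma inv_cosh_half_sum (x y : R) : 0 < x -> 0 < y ->
  let r := 1 / cosh x in let s := 1 / cosh y in
  sqrt (2 * r * s) / sqrt (1 + r * s + comodulus r * comodulus s) =
  1 / cosh ((x + y) / 2).
Proof.
intros Hx Hy r s; unfold r, s.
rewrite -> !comodulus_inv_cosh by trivial.
assert (Hcx := cosh_pos x); assert (Hcy := cosh_pos y).
assert (Hsx := sinh_pos x Hx); assert (Hsy := sinh_pos y Hy).
assert (Hc := cosh_pos ((x + y) / 2)).
assert (Hm := cosh_half_sum x y).
assert (Hden : 1 + 1 / cosh x * (1 / cosh y) + sinh x / cosh x * (sinh y / cosh y) =
  2 * cosh ((x + y) / 2) ^ 2 / (cosh x * cosh y)).
{ rewrite Hm; field; lra. }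
rewrite Hden -sqrt_div_alt.
- replace (_ / _) with ((1 / cosh ((x + y) / 2)) ^ 2) by (field; lra).
  rewrite sqrt_pow2 //; apply Rlt_le, Rdiv_lt_0_compat; lra.
- apply Rdiv_lt_0_compat; nra.
Qed.

Theorem theorem1p9 :
  (let f := fun x : R => psi (1 / cosh x) in
   decreasing_on f pos_reals /\
   convex_on f pos_reals /\
   maps_onto f pos_reals pos_reals) /\
  (forall r s : R, 0 < r < 1 -> 0 < s < 1 ->
     let r' := comodulus r in
     let s' := comodulus s in
     let m := sqrt (2 * r * s) / sqrt (1 + r * s + r' * s') in
     2 * psi m <= psi r + psi s /\
     (2 * psi m = psi r + psi s <-> r = s)).
Proof.
split.
- intros f; split; [ | split; [ | split]].
  + intros x y Hx _ Hxy; now apply psi_sech_lt.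
  + intros x y t Hx Hy Ht; change f with psi_sech; unfold pos_reals in *.
    (* The degenerate cases [t = 0], [t = 1] and [x = y] lie outside strict convexity and give
       equality. *)
    destruct (Req_dec t 0) as [-> | Ht0].
    { right; replace (0 * x + (1 - 0) * y) with y by ring; ring. }
    destruct (Req_dec t 1) as [-> | Ht1].
    { right; replace (1 * x + (1 - 1) * y) with x by ring; ring. }
    destruct (Rtotal_order x y) as [Hxy | [<- | Hxy]].
    * left; apply psi_sech_strict_convex; lra.
    * right; replace (t * x + (1 - t) * x) with x by ring; ring.
    (* Strict convexity is stated for ordered points, so the points and their weights are
       exchanged. *)
    * left; assert (H := psi_sech_strict_convex y x (1 - t) Hy Hxy ltac:(lra)).
      replace (1 - (1 - t)) with t in H by ring.
      rewrite (Rplus_comm (t * x)) (Rplus_comm (t * psi_sech x)); exact H.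
  + intros x Hx; now apply psi_pos, inv_cosh_bound.
  + intros y Hy; destruct (psi_surj y Hy) as [r [Hr <-]].
    destruct (inv_cosh_surj r Hr) as [x [Hx <-]]; now exists x.
- intros r s Hr Hs.
  destruct (inv_cosh_surj r Hr) as [x [Hx <-]].
  destruct (inv_cosh_surj s Hs) as [y [Hy <-]].
  intros r' s' m.
  replace (psi m) with (psi_sech ((x + y) / 2)).
  2:{ unfold m, r', s'; now rewrite inv_cosh_half_sum. }
  change (psi (1 / cosh x)) with (psi_sech x).
  change (psi (1 / cosh y)) with (psi_sech y).
  assert (Hmid : forall a b, 0 < a -> a < b ->
    2 * psi_sech ((a + b) / 2) < psi_sech a + psi_sech b).
  { intros a b Ha Hab.
    assert (H := psi_sech_strict_convex a b (1 / 2) Ha Hab ltac:(lra)).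
    replace (1 / 2 * a + (1 - 1 / 2) * b) with ((a + b) / 2) in H by field.
    lra. }
  destruct (Rtotal_order x y) as [Hxy | [<- | Hxy]].
  (* Distinct arguments give distinct moduli, so both sides of the equivalence are false. *)
  + assert (H := Hmid x y Hx Hxy); assert (H1 := inv_cosh_lt x y Hx Hxy).
    split; [lra | split; lra].
  + replace ((x + x) / 2) with x by field; split; [lra | split; lra].
  + assert (H := Hmid y x Hy Hxy); assert (H1 := inv_cosh_lt y x Hy Hxy).
    rewrite (Rplus_comm y) in H.
    split; [lra | split; lra].
Qed.
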